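(* Let $S\subset\mathbb{R}^n$ be a semi-algebraic set defined by symmetric polynomials in $\mathbb{R}[X_1,\ldots,X_n]$ of degree at most $d$. Then $S\neq\emptyset$ if and only if $S\cap A_k\neq\emptyset$, where $k:=\max\{2,d\}$.
   Context: A polynomial in $\mathbb{R}[X_1,\ldots,X_n]$ is symmetric if it is invariant under all permutations of the variables. A semi-algebraic set is a subset of $\mathbb{R}^n$ defined by a Boolean formula whose atoms are polynomial equalities and inequalities; it is defined by polynomials $f_1,\ldots,f_m$ if the equalities and inequalities appearing in its description are given by $f_1,\ldots,f_m$ (i.e., each atom compares one of the $f_i$ with $0$). For $x=(x_1,\ldots,x_n)\in\mathbb{R}^n$ let $\pi(x):=|\{x_1,\ldots,x_n\}|$ be the number of distinct coordinates of $x$, and for a positive integer $k$ set $A_k:=\{x\in\mathbb{R}^n: \pi(x)\le k\}$. *)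

(* Defs.v *)
From mathcomp Require Import all_boot all_order all_algebra.
From mathcomp Require Import classical_sets reals.
(* The notations of mpoly are left out: they are incompatible with those of
   mathcomp-analysis.  Hence [mpoly n R] stands for {mpoly R[n]}, [meval v p]
   for p.@[v], and the abbreviation [msize] is qualified. *)
From mathcomp Require Import -(notations) mpoly.

Set Implicit Arguments.
Unset Strict Implicit.
Unset Printing Implicit Defensive.

Import Order.TTheory GRing.Theory Num.Theory.
Local Open Scope classical_set_scope.
Local Open Scope ring_scope.

Inductive sign_condition := Eq0 | Lt0 | Le0 | Gt0 | Ge0.

Definition sign_holds (R : realType) (c : sign_condition) (y : R) : bool :=
  match c with
  | Eq0 => y == 0
  | Lt0 => y < 0
  | Le0 => y <= 0
  | Gt0 => 0 < y
  | Ge0 => 0 <= y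
  end.

(* [SAAtom i c] compares the [i]-th polynomial of a family with 0. *)
Inductive sa_formula (m : nat) :=
  | SABool of bool
  | SAAtom of 'I_m & sign_condition
  | SANot of sa_formula m
  | SAAnd of sa_formula m & sa_formula m
  | SAOr of sa_formula m & sa_formula m.

Fixpoint sa_holds (R : realType) (n m : nat) (f : 'I_m -> mpoly n R)
    (phi : sa_formula m) (x : 'rV[R]_n) : bool :=
  match phi with
  | SABool b => b
  | SAAtom i c => sign_holds c (meval (x ord0) (f i))
  | SANot p => ~~ sa_holds f p x
  | SAAnd p q => sa_holds f p x && sa_holds f q x
  | SAOr p q => sa_holds f p x || sa_holds f q x
  end.

Definition semialgebraic_defined_by (R : realType) (n m : nat)
    (f : 'I_m -> mpoly n R) (S : set 'rV[R]_n) : Prop :=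
  exists phi : sa_formula m, S = [set x | sa_holds f phi x].

Definition num_distinct_coords (R : realType) (n : nat) (x : 'rV[R]_n) : nat :=
  size (undup (codom (x ord0))).

Definition few_coords_set (R : realType) (n k : nat) : set 'rV[R]_n :=
  [set x | (num_distinct_coords x <= k)%N].
Arguments few_coords_set : clear implicits.

(* [msize p] is the total degree of [p] plus one when [p != 0], and
   [msize 0 = 0]; the zero polynomial satisfies every degree bound. *)
Definition degree_at_most (R : realType) (n d : nat) (p : mpoly n R) :=
  (mpoly.msize p <= d.+1)%N.

(* Main.v *)
Require Import Defs.
From mathcomp Require Import all_boot all_order all_algebra.
From mathcomp Require Import perm lra.
From mathcomp Require Import boolp classical_sets reals.
From mathcomp Require Import topology normedtype matrix_normedtype derive realfun.
From mathcomp Require Import -(notations) mpoly.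

(** Write e_j for the elementary symmetric polynomials and let k = max(2, d).

A symmetric polynomial of degree at most d is a polynomial in e_1, ..., e_d
([meval_symmetric_mesym]), so whether a point lies in S depends only on the
values of e_1, ..., e_k there.  It is therefore enough to find, in the fiber of
(e_1, ..., e_k) through a given point of S, a point with at most k distinct
coordinates ([mesym_fiber_few_coords]).

Since k >= 2 the fiber fixes the sum of the squares of the coordinates, so it
is compact ([compact_mesym_fiber]) and e_(k+1) has a maximum on it, say at y.
Suppose that y had k+1 distinct coordinates, at the indices in A.  The
polynomial Q = prod_(i in A) (T - y_i) has only simple real roots, hence so has
Q + c for every small enough constant c ([simple_real_roots_stable]).  Replacing
the coordinates of y in A by the roots of Q + c changes prod_i (T - y_i) by
c * W, with W = prod_(i not in A) (T - y_i) monic of degree n - k - 1.  By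
Viete's formulas this keeps e_1, ..., e_k and moves e_(k+1) by c, up to a sign
that does not depend on c; so for a suitable sign of c it increases e_(k+1)
([increase_next_mesym]), against the choice of y. *)

Set Implicit Arguments.
Unset Strict Implicit.
Unset Printing Implicit Defensive.

Import Order.TTheory GRing.Theory Num.Theory numFieldNormedType.Exports.
Local Open Scope classical_set_scope.
Local Open Scope ring_scope.

Lemma fin_pos_lower_bound (R : realDomainType) (I : finType) (P : pred I)
    (F : I -> R) :
  (forall i, P i -> 0 < F i) ->
  exists2 e, 0 < e & forall i, P i -> e <= F i.
Proof.
move=> F_gt0; exists (\big[Num.min/1]_(i | P i) F i).
  exact: lt_bigmin.
by move=> i Pi; exact: bigmin_le_cond.
Qed.

Lemma opp_sign_add (R : realDomainType) (u v c : R) :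
  u * v < 0 -> `|c| <= `|u| -> `|c| <= `|v| -> (u + c) * (v + c) <= 0.
Proof.
move=> uv; case: (ger0P u) => u0; case: (ger0P v) => v0; rewrite ?ler_norml.
all: move=> /andP[? ?] /andP[? ?]; nra.
Qed.

Lemma poly_root_of_opp_sign (R : rcfType) (p : {poly R}) (a b : R) :
  a <= b -> p.[a] * p.[b] <= 0 -> exists2 x, a <= x <= b & root p x.
Proof.
move=> ab pab; have [pa|/ltW pa] := lerP p.[a] 0.
  have [pa0|pan0] := eqVneq p.[a] 0.
    by exists a; rewrite ?lexx // /root pa0.
  by apply: poly_ivt => //; rewrite pa -(nmulr_rle0 _ (_ : p.[a] < 0)) // lt_neqAle pan0.
have [pa0|pan0] := eqVneq p.[a] 0.
  by exists a; rewrite ?lexx // /root pa0.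
have [|x ? rx] := @poly_ivt R (- p) a b ab.
  by rewrite !hornerN oppr_le0 oppr_ge0 pa -(pmulr_rle0 _ (_ : 0 < p.[a])) // lt_neqAle eq_sym pan0.
by exists x => //; rewrite -rootN.
Qed.

(** A polynomial changes sign at each simple root.  A constant smaller than its
values next to the roots preserves these sign changes, so the perturbed
polynomial has a root near each of the original ones; these are as many as its
degree. *)
Lemma simple_real_roots_stable (R : rcfType) (I : finType) (A : {set I})
    (a : I -> R) :
  (0 < #|A|)%N -> {in A &, injective a} ->
  exists2 e, 0 < e & forall c, `|c| <= e -> exists b : I -> R,
    \prod_(i in A) ('X - (b i)%:P) = \prod_(i in A) ('X - (a i)%:P) + c%:P.
Proof.
move=> A_gt0 a_inj; set Q := \prod_(i in A) ('X - (a i)%:P).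
(* With 2 * r below all gaps the intervals [a i - r, a i + r] are disjoint. *)
have [r r_gt0 sep] : exists2 r, 0 < r & forall i j, i \in A -> j \in A ->
    i != j -> 3 * r <= `|a i - a j|.
  have [|e e_gt0 le_e] := @fin_pos_lower_bound R (I * I)%type
    [pred ij | [&& ij.1 \in A, ij.2 \in A & ij.1 != ij.2]]
    (fun ij => `|a ij.1 - a ij.2|).
    move=> [i j] /and3P[/= iA jA]; rewrite normr_gt0 subr_eq0.
    by apply: contra_neq; exact: a_inj.
  exists (e / 3) => [|i j iA jA ij]; first lra.
  have := le_e (i, j); rewrite /= iA jA ij => /(_ isT).
  by move=> H; apply: le_trans H; lra.
have Q_opp i : i \in A -> Q.[a i - r] * Q.[a i + r] < 0.
  (* Q(a_i - r) * Q(a_i + r) is the product over j of (a_j - a_i)^2 - r^2, where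
     only the factor j = i is negative. *)
  move=> iA; rewrite !horner_prod -big_split /= (bigD1 i) //= !hornerXsubC.
  rewrite nmulr_rlt0; last by nra.
  apply: prodr_gt0 => j /andP[jA ji]; rewrite !hornerXsubC.
  have := sep _ _ jA iA ji; case: (ger0P (a j - a i)); nra.
have [e e_gt0 le_e] : exists2 e, 0 < e & forall i, i \in A ->
    e <= Num.min `|Q.[a i - r]| `|Q.[a i + r]|.
  apply: fin_pos_lower_bound => i /Q_opp Qi.
  rewrite lt_min !normr_gt0 -negb_or -mulf_eq0.
  by rewrite lt_eqF.
exists e => // c c_le.
have sizeQ : size Q = #|A|.+1.
  by rewrite /Q -big_enum size_prod_XsubC cardE.
have size_c : (size (c%:P : {poly R}) < size Q)%N.
  by rewrite sizeQ; apply: leq_ltn_trans (size_polyC_leq1 c) _.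
have [b b_near b_root] : exists2 b : I -> R,
    forall i, i \in A -> a i - r <= b i <= a i + r &
    forall i, i \in A -> root (Q + c%:P) (b i).
  have H i : exists2 x, i \in A -> a i - r <= x <= a i + r &
      i \in A -> root (Q + c%:P) x; last by exact: (fin_all_exists2 H).
  have [iA|_] := boolP (i \in A); last by exists 0.
  have /andP[le_e1 le_e2]: (`|c| <= `|Q.[a i - r]|) && (`|c| <= `|Q.[a i + r]|).
    by rewrite -le_min (le_trans c_le) // le_e.
  have [||x x_near x_root] := @poly_root_of_opp_sign R (Q + c%:P) (a i - r) (a i + r).
  - by lra.
  - by rewrite !hornerE opp_sign_add // Q_opp.
  by exists x.
have b_inj : {in A &, injective b}.
  move=> i j iA jA bij; apply/eqP; apply: contraT => /(sep _ _ iA jA).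
  move: (b_near _ iA) (b_near _ jA); rewrite bij => /andP[? ?] /andP[? ?].
  by case: (ger0P (a i - a j)); lra.
exists b.
rewrite (@all_roots_prod_XsubC _ (Q + c%:P) [seq b i | i <- enum A]).
- by rewrite lead_coefDl // (monicP (monic_prod_XsubC _ _ _)) scale1r big_map big_enum.
- by rewrite size_polyDl // sizeQ size_map cardE.
- by apply/allP => z /mapP[i iA ->]; apply: b_root; rewrite -mem_enum.
rewrite uniq_rootsE map_inj_in_uniq ?enum_uniq //.
by move=> i j; rewrite !mem_enum => iA jA; exact: b_inj.
Qed.

Lemma ex_injective_subset (T : finType) (U : eqType) (y : T -> U) (k : nat) :
  (k <= size (undup (codom y)))%N ->
  exists2 A : {set T}, #|A| = k & {in A &, injective y}.
Proof.
set t := undup _ => k_le; pose u := take k t.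
have u_uniq : uniq u by rewrite take_uniq // undup_uniq.
have [s ys] : exists s, [seq y i | i <- s] = u.
  have : {subset u <= codom y} by move=> z /mem_take; rewrite mem_undup.
  elim: (u) => [|z v IHv] sub; first by exists [::].
  have [s <-] : exists s, [seq y i | i <- s] = v.
    by apply: IHv => w wv; apply: sub; rewrite inE wv orbT.
  have /codomP[i ->] := sub z (mem_head _ _).
  by exists (i :: s).
have s_uniq : uniq s by apply: (@map_uniq _ _ y); rewrite ys.
exists [set i in s].
  by rewrite cardsE (card_uniqP s_uniq) -(size_map y) ys size_takel.
have enum_s : perm_eq (enum [set i in s]) s.
  by apply: uniq_perm => //; [exact: enum_uniq|move=> i; rewrite mem_enum inE].
by apply/dinjectiveP; rewrite /dinjectiveb (perm_uniq (perm_map y enum_s)) ys.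
Qed.

(** The fundamental theorem writes p = t(e_1, ..., e_n) with the weight of t, in
which the variable of e_i counts i, at most the degree of p.  So only e_i with
i <= d can occur in t. *)
Lemma meval_symmetric_mesym (R : comNzRingType) (n d : nat) (p : mpoly n R)
    (u v : 'I_n -> R) :
  p \is symmetric -> (mpoly.msize p <= d.+1)%N ->
  (forall i, (i <= d)%N -> meval u (mesym n R i) = meval v (mesym n R i)) ->
  meval u p = meval v p.
Proof.
move=> /sym_fundamental[t [<- t_wgt]] p_deg uv.
rewrite !comp_mpoly_meval !mevalE !big_seq; apply: eq_bigr => m mt.
congr (_ * _); apply: eq_bigr => i _; rewrite !tnth_mktuple.
have [id|di] := leqP i.+1 d; first by rewrite uv.
suff -> : m i = 0%N by [].
have m_wgt : (mnmwgt m <= d)%N.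
  by rewrite -ltnS (leq_trans (mmeasure_mnm_lt _ mt)) // (leq_trans t_wgt).
apply/eqP; rewrite -leqn0 -ltnS -(ltn_pmul2r (ltn0Sn i)) mul1n.
apply: leq_ltn_trans di; apply: leq_trans m_wgt.
by rewrite /mnmwgt (bigD1 i) //= leq_addr.
Qed.

(** The quadratic case of [meval_symmetric_mesym], which makes the fibers of
(e_1, ..., e_k) bounded for k >= 2. *)
Lemma sum_sqr_mesym (R : comNzRingType) (n : nat) (u v : 'I_n -> R) :
  (forall i, (i <= 2)%N -> meval u (mesym n R i) = meval v (mesym n R i)) ->
  \sum_i u i ^+ 2 = \sum_i v i ^+ 2.
Proof.
move=> uv; pose p : mpoly n R := \sum_i mpolyX R (mnm1 i) ^+ 2.
have meval_p w : meval w p = \sum_i w i ^+ 2.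
  by rewrite raddf_sum; apply: eq_bigr => i _; rewrite /= expr2 mevalM mevalXU.
rewrite -!meval_p; apply: (@meval_symmetric_mesym _ _ 2) => //.
  apply/issymP => s; rewrite raddf_sum [RHS](reindex_inj (@perm_inj _ s)).
  have msym_var i : msym s (mpolyX R (mnm1 i)) = mpolyX R (mnm1 (s i)).
    rewrite msymX; congr mpolyX; apply/mnmP => j; rewrite mnmE !mnm1E.
    by congr (nat_of_bool _); apply/eqP/eqP => [->|<-]; rewrite ?permK ?permKV.
  by apply: eq_bigr => i _; rewrite /= !expr2 msymM msym_var.
apply: leq_trans (mmeasure_sum _ _ _ _) _; apply/bigmax_leqP => i _.
by rewrite mpolyXn msizeX mdegMn mdeg1.
Qed.

Lemma continuous_meval (R : realType) (n : nat) (p : mpoly n R) :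
  continuous (fun y : 'rV[R]_n => meval (y ord0) p).
Proof.
under eq_fun do rewrite mevalE.
apply: (@continuous_big R) => [|m _]; first exact: add_continuous.
move=> y; apply: continuousM; first exact: cst_continuous.
move: y; apply: (@continuous_big R) => [|i _]; first exact: mul_continuous.
move=> y; apply: (@continuous_comp _ _ _ (fun y : 'rV[R]_n => y ord0 i) (fun t : R => t ^+ m i)).
  exact: coord_continuous.
exact: exprn_continuous.
Qed.

Lemma mesym_viete_coef (R : idomainType) (n j : nat) (w : 'I_n -> R) :
  (j <= n)%N ->
  (\prod_i ('X - (w i)%:P))`_(n - j) = (-1) ^+ j * meval w (mesym n R j).
Proof.
move=> jn; have := mroots_coeff [tuple w i | i < n] (Ordinal (jn : (j < n.+1)%N)).
rewrite big_tuple /= => E.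
rewrite (eq_bigr (fun i => 'X - (tnth [tuple w i | i < n] i)%:P)).
  by rewrite E; congr (_ * _); apply: meval_eq => i; rewrite tnth_mktuple.
by move=> i _; rewrite tnth_mktuple.
Qed.

(** Perturbing the constant term of the factor carried by k+1 distinct
coordinates affects prod_i (T - y_i) only in degrees at most n - k - 1, that is,
only e_j with j > k. *)
Lemma increase_next_mesym (R : rcfType) (n k : nat) (y : 'I_n -> R) :
  (k < size (undup (codom y)))%N ->
  exists2 z : 'I_n -> R,
    forall j, (j <= k)%N -> meval z (mesym n R j) = meval y (mesym n R j) &
    meval y (mesym n R k.+1) < meval z (mesym n R k.+1).
Proof.
move=> /ex_injective_subset[A cardA y_inj].
have [|e e_gt0] := simple_real_roots_stable _ y_inj; first by rewrite cardA.
(* The coefficient of degree n - k - 1 is (-1)^(k+1) e_(k+1): this sign of the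
   perturbation makes e_(k+1) grow. *)
move=> /(_ ((-1) ^+ k.+1 * e)); rewrite normrMsign gtr0_norm // => /(_ (lexx _)).
set c := _ * e => -[b prod_b].
have kn : (k < n)%N by rewrite -cardA -[n in leqRHS]card_ord max_card.
pose z i := if i \in A then b i else y i.
pose W : {poly R} := \prod_(i in ~: A) ('X - (y i)%:P).
have prod_z : \prod_i ('X - (z i)%:P) = \prod_i ('X - (y i)%:P) + c *: W.
  have W_notin : W = \prod_(i | i \notin A) ('X - (y i)%:P).
    by apply: eq_bigl => i; rewrite inE.
  rewrite (bigID (mem A)) [\prod_i ('X - (y i)%:P)](bigID (mem A)) /=.
  rewrite -W_notin -mul_polyC -mulrDl -prod_b W_notin; congr (_ * _).
    by apply: eq_bigr => i iA; rewrite /z iA.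
  by apply: eq_bigr => i /negbTE iA; rewrite /z iA.
have sizeW : size W = (n - k)%N.
  by rewrite /W -big_enum size_prod_XsubC -cardE cardsCs finset.setCK cardA card_ord subnSK.
have coef_z j : (j <= n)%N -> (-1) ^+ j * meval z (mesym n R j) =
    (-1) ^+ j * meval y (mesym n R j) + c * W`_(n - j).
  by move=> jn; rewrite -!mesym_viete_coef // prod_z coefD coefZ.
exists z => [j jk|].
  apply: (mulfI (negbT (signr_eq0 R j))); rewrite coef_z ?(leq_trans jk) 1?ltnW //.
  by rewrite [W`_ _]nth_default ?mulr0 ?addr0 // sizeW leq_sub2l.
have W_lead : W`_(n - k.+1) = 1.
  have /monicP <- : W \is monic by exact: monic_prod_XsubC.
  by rewrite lead_coefE sizeW subnS.
suff -> : meval z (mesym n R k.+1) = meval y (mesym n R k.+1) + e.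
  by rewrite ltrDl.
by apply: (mulfI (negbT (signr_eq0 R k.+1))); rewrite coef_z // W_lead mulr1 mulrDr.
Qed.

Lemma compact_mesym_fiber (R : realType) (n k : nat) (x : 'rV[R]_n) :
  (2 <= k)%N ->
  compact [set y : 'rV[R]_n | forall i, (i <= k)%N ->
    meval (y ord0) (mesym n R i) = meval (x ord0) (mesym n R i)].
Proof.
move=> k_ge2; apply: bounded_closed_compact.
  pose B := \sum_i x ord0 i ^+ 2.
  exists (1 + B); split; first exact: num_real.
  move=> r Br y /= xy.
  have norms : \sum_i y ord0 i ^+ 2 = B.
    by apply: sum_sqr_mesym => i i2; apply: xy; exact: leq_trans k_ge2.
  rewrite [leLHS]/Num.norm /= mx_normrE; apply: bigmax_le => [|[i j] _ /=].
    apply: le_trans (ltW Br); rewrite addr_ge0 // sumr_ge0 // => i _.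
    exact: sqr_ge0.
  apply: le_trans (ltW Br); rewrite (ord1 i).
  have : y ord0 j ^+ 2 <= B.
    rewrite -norms (bigD1 j) //= lerDl sumr_ge0 // => l _; exact: sqr_ge0.
  (* t ^ 2 <= B gives |t| <= 1 + B without square roots. *)
  rewrite ler_norml; move: (y ord0 j) => t tB; apply/andP; split; nra.
rewrite (_ : mkset _ = \bigcap_(i in [set i | (i <= k)%N])
  ((fun y : 'rV[R]_n => meval (y ord0) (mesym n R i)) @^-1`
     [set meval (x ord0) (mesym n R i)])); last first.
  by apply/seteqP; split => y /= xy i /= ik; apply: xy.
apply: closed_bigI => i _; apply: preimage_closed => [y _|]; last exact: closed_eq.
exact: continuous_meval.
Qed.

(** A point where e_(k+1) is maximal on the compact fiber cannot have more than k
distinct coordinates, by [increase_next_mesym]. *)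
Lemma mesym_fiber_few_coords (R : realType) (n k : nat) (x : 'rV[R]_n) :
  (2 <= k)%N ->
  exists2 y : 'rV[R]_n, (num_distinct_coords y <= k)%N &
    forall i, (i <= k)%N ->
      meval (y ord0) (mesym n R i) = meval (x ord0) (mesym n R i).
Proof.
move=> k_ge2.
have [|y] := compact_EVT_max _ (@compact_mesym_fiber R n k x k_ge2)
   (continuous_subspaceT (@continuous_meval R n (mesym n R k.+1))).
  by exists x.
rewrite inE /= => xy y_max; exists y => //.
rewrite leqNgt; apply/negP => /increase_next_mesym[z yz].
pose z' : 'rV[R]_n := \row_i z i.
have z'E j : meval (z' ord0) (mesym n R j) = meval z (mesym n R j).
  by apply: meval_eq => i; rewrite mxE.
rewrite ltNge -z'E => /negP; apply; apply: y_max; rewrite inE /= => i ik.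
by rewrite z'E yz // xy.
Qed.

Lemma sa_holds_eq (R : realType) (n m : nat) (f : 'I_m -> mpoly n R)
    (phi : sa_formula m) (x y : 'rV[R]_n) :
  (forall i, meval (x ord0) (f i) = meval (y ord0) (f i)) ->
  sa_holds f phi x = sa_holds f phi y.
Proof.
move=> xy; elim: phi => //= [i c|p ->|p -> q ->|p -> q ->] //.
by rewrite xy.
Qed.

Theorem corollary2p7 (R : realType) (n d m : nat)
    (f : 'I_m -> mpoly n R) (S : set 'rV[R]_n)
    (fsym : forall i : 'I_m, f i \is symmetric)
    (fdeg : forall i : 'I_m, degree_at_most d (f i))
    (S_def : semialgebraic_defined_by f S) :
  S !=set0 <-> (S `&` few_coords_set R n (maxn 2 d)) !=set0.
Proof.
split=> [[x Sx]|[x [Sx _]]]; last by exists x.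
have [y y_few xy] := @mesym_fiber_few_coords R n _ x (leq_maxl 2 d).
exists y; split => //; case: S_def Sx => phi -> /=.
rewrite (@sa_holds_eq _ _ _ _ _ x y) // => i.
apply: (meval_symmetric_mesym (fsym i) (fdeg i)) => j jd.
by rewrite xy // (leq_trans jd) // leq_maxr.
Qed.
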